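(* Assume that $d\ge 2$. Then there exists $\delta>0$, depending on the offspring distribution $\mathcal{Q}$, such that $$\lim_{n\to\infty}P(V_n\ge \delta\log n\mid G_n)=1.$$
   Context: Branching random walk: a nearest neighbor branching random walk on $\mathbb{Z}^d$ with offspring distribution $\mathcal{Q}=\{Q_l\}_{l\ge 0}$ evolves as follows: at each time $n=0,1,2,\dots$ every particle independently produces a random number of offspring with law $\mathcal{Q}$ (which replace it), and each offspring independently moves to a site chosen uniformly at random from the $2d+1$ sites at distance $\le 1$ from the location of its parent. Standing assumptions: $\mathcal{Q}$ has mean $1$ (criticality) and finite, positive variance $\sigma^2$; the process is started by a single particle at the origin at time $0$. Notation: $U_n(x)$ is the number of particles at site $x$ in generation $n$; $V_n=\max_{x\in\mathbb{Z}^d}U_n(x)$; $G_n$ is the event that the process survives to generation $n$ (at least one particle in generation $n$). *)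

(* Defs.v *)
From HB Require Import structures.
From mathcomp Require Import all_boot all_order all_algebra.
From mathcomp Require Import finmap.
From mathcomp Require Import all_classical all_reals all_analysis.

Set Implicit Arguments.
Unset Strict Implicit.
Unset Printing Implicit Defensive.

Import Order.TTheory GRing.Theory Num.Theory.
Import numFieldNormedType.Exports.

Local Open Scope classical_set_scope.
Local Open Scope ring_scope.

Definition site (d : nat) := 'rV[int]_d.

HB.instance Definition _ (d : nat) := GRing.Zmodule.on (site d).
HB.instance Definition _ (d : nat) := isPointed.Build (site d) 0.
HB.instance Definition _ (d : nat) := @isMeasurable.Build default_measure_display
  (site d) discrete_measurable discrete_measurable0
  discrete_measurableC discrete_measurableU.

(* Nearest-neighbour graph distance on Z^d. *)
Definition lattice_dist (d : nat) (x y : site d) : int :=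
  \sum_(i < d) `|x ord0 i - y ord0 i|.

Section Probability.
Context {dOm : measure_display} {Omega : measurableType dOm} {R : realType}.
Variable P : probability Omega R.

Definition cond_prob (A B : set Omega) : R := fine (P (A `&` B)) / fine (P B).

(* Mutual independence of a family of classes of events. *)
Definition mutually_independent (I : choiceType)
    (E : I -> set (set Omega)) : Prop :=
  forall (J : {fset I}) (A : I -> set Omega),
    (forall i, i \in J -> E i (A i)) ->
    P (\bigcap_(i in [set` J]) A i) = (\prod_(i <- J) P (A i))%E.

(* The sigma-algebra generated by X. *)
Definition sigma_rv {d'} {T' : measurableType d'} (X : {RV P >-> T'}) :
    set (set Omega) :=
  preimage_set_system [set: Omega] X measurable.

End Probability.

(* Ulam-Harris label of a (potential) particle: its birth rank among its
   siblings, followed by the label of its parent; the ancestor is [::]. *)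
Definition label := seq nat.

Section BranchingRandomWalk.
Context {dOm : measure_display} {Omega : measurableType dOm} {R : realType}.
Variables (P : probability Omega R) (d : nat).

(* offspring u is the number of offspring of the particle u; step u k is the
   displacement of its k-th offspring relative to u.  Both are defined for all
   labels; only the labels of particles that are actually born are used. *)
Variables (offspring : label -> {RV P >-> nat})
          (step : label -> nat -> {RV P >-> site d}).

Definition driving_sigma (i : label + label * nat) : set (set Omega) :=
  match i with
  | inl u => sigma_rv (offspring u)
  | inr (u, k) => sigma_rv (step u k)
  end.

Record is_brw (Q : probability nat R) : Prop := IsBRW {
  brw_offspring : forall u B, distribution P (offspring u) B = Q B;
  brw_step : forall u k (x : site d),
    distribution P (step u k) [set x] =
      (if lattice_dist x 0 <= 1 then (2 * d + 1)%N%:R^-1 else 0)%:E;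
  brw_indep : mutually_independent P driving_sigma
}.

Fixpoint generation (n : nat) (w : Omega) : seq label :=
  if n is m.+1 then
    [seq k :: u | u <- generation m w, k <- iota 0 (offspring u w)]
  else [:: [::]].

Fixpoint position (u : label) (w : Omega) : site d :=
  if u is k :: v then position v w + step v k w else 0.

Definition U (n : nat) (x : site d) (w : Omega) : nat :=
  count (fun u => position u w == x) (generation n w).

(* The maximum over Z^d, as a supremum in \bar R; it is attained because only
   finitely many U n x w are nonzero. *)
Definition V (n : nat) (w : Omega) : \bar R :=
  ereal_sup [set ((U n x w)%:R)%:E | x in [set: site d]].

Definition survival (n : nat) : set Omega :=
  [set w | (0 < size (generation n w))%N].

End BranchingRandomWalk.

(* Main.v *)
Require Import Defs.
From mathcomp Require Import finmap.
From mathcomp Require Import all_boot all_order all_algebra.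
From mathcomp Require Import all_classical all_reals all_analysis.
From mathcomp Require Import ring lra zify.
Import Order.TTheory GRing.Theory Num.Theory.
Import numFieldNormedType.Exports.

Set Implicit Arguments.
Unset Strict Implicit.
Unset Printing Implicit Defensive.

Local Open Scope classical_set_scope.
Local Open Scope ring_scope.

(* The maximum is already large because of a single rigid configuration.  Fix
   b >= 2 with Q{b} > 0.  With probability at least th^(b^k), where
   th = Q{b} (2d+1)^(-b), all descendants of a particle during k generations have
   exactly b children and never move, which puts b^k particles at one site.  For
   b^k of order delta log n with delta small, so that k is of order log log n,
   this probability is at least a constant times n^(-1/4).  On the other hand,
   given survival up to time n, generation m = n - k has with high probability
   at least sqrt n particles; they reproduce independently, so all of them fail
   to produce such a configuration with probability at most exp(-c n^(1/4)),
   negligible with respect to P(G_n), which is at least c / n.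

   The survival probabilities p_n satisfy p_(n+1) = 1 - f(1 - p_n), where f is
   the generating function of Q, and 1 - p + Q{b} p^2 <= f(1 - p) <= 1 - p +
   sigma^2 p^2 shows that p_n is of order 1/n and that p_m - p_(m+j) is at most
   j sigma^2 p_m^2.  If 0 < Z_m <= K and K p_j <= 1/2, then extinction occurs
   before time m + j with conditional probability at least 1/2, hence
   P(0 < Z_m <= K) <= 2 (p_m - p_(m+j)), which is o(p_m) for K of order sqrt n. *)

(** * Independence of generated sigma-algebras *)

Lemma bigcap_seq_cons {T : Type} {X : eqType} (x : X) (L : seq X) (A : X -> set T) :
  \bigcap_(y in [set` x :: L]) A y = A x `&` \bigcap_(y in [set` L]) A y.
Proof.
apply/seteqP; split => [w H|w [Ax H] y /=].
  split; first by apply: H; rewrite /= mem_head.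
  by move=> y /= yL; apply: H; rewrite /= inE yL orbT.
by rewrite inE => /predU1P[->//|]; exact: H.
Qed.

Lemma sigma_algebra_setI {T : Type} (F : set (set T)) A B :
  sigma_algebra setT F -> F A -> F B -> F (A `&` B).
Proof.
move=> [F0 FC FU] FA FB.
rewrite -(setCK (A `&` B)) setCI -!setTD; apply: (FC).
by rewrite -bigcup2E; apply: FU => -[|[|n]] //=; apply: FC.
Qed.

Section Independence.
Context {dOm : measure_display} {Omega : measurableType dOm} {R : realType}.
Variable P : probability Omega R.
Context {I : choiceType}.
Variable E : I -> set (set Omega).
Hypothesis E_measurable : forall i, E i `<=` measurable.
Hypothesis E_sigma : forall i, sigma_algebra [set: Omega] (E i).
Hypothesis E_indep : mutually_independent P E.

(** The pi-system that generates the joint sigma-algebra of the classes indexed by [S]. The family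
    [A] is total, with [E i (A i)] even outside [J], so that two families can be merged
    pointwise. *)
Definition cylinder (S : set I) : set (set Omega) :=
  [set B | exists (J : {fset I}) (A : I -> set Omega),
    [/\ forall i, E i (A i), [set` J] `<=` S & B = \bigcap_(i in [set` J]) A i]].

Lemma class_setT i : E i [set: Omega].
Proof. by case: (E_sigma i) => E0 EC _; rewrite -(setD0 setT); exact: EC. Qed.

Lemma class_setI i A B : E i A -> E i B -> E i (A `&` B).
Proof. by move=> ? ?; apply: (sigma_algebra_setI (E_sigma i)). Qed.

Lemma cylinder_setI S : setI_closed (cylinder S).
Proof.
move=> _ _ [J [A [EA JS ->]]] [J' [A' [EA' JS' ->]]].
exists (J `|` J')%fset; exists (fun i =>
  (if i \in J then A i else setT) `&` (if i \in J' then A' i else setT)); split.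
- by move=> i; apply: class_setI; case: ifP => _ //; exact: class_setT.
- by move=> i /=; rewrite inE => /orP[/JS|/JS'].
- apply/seteqP; split => [w [HA HA'] i /= _|w H].
    by split; case: ifP => iJ //; [exact: HA|exact: HA'].
  split=> i /= iJ.
    by have := H i; rewrite /= inE iJ => /(_ isT) [].
  by have := H i; rewrite /= inE iJ orbT => /(_ isT) [].
Qed.

Lemma cylinder_sub_measurable S : cylinder S `<=` measurable.
Proof.
move=> _ [J [A [EA JS ->]]].
have -> : [set` J] = [set` enum_fset J] by [].
apply: fin_bigcap_measurable => // i _; exact/E_measurable/EA.
Qed.

Lemma cylinder_indep S S' B B' : S `&` S' = set0 ->
  cylinder S B -> cylinder S' B' -> P (B `&` B') = (P B * P B')%E.
Proof.
move=> SS' [J [A [EA JS ->]]] [J' [A' [EA' JS' ->]]].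
have JJ' i : i \in J -> i \notin J'.
  move=> iJ; apply/negP => iJ'.
  by have : (S `&` S') i; [split; [exact: JS|exact: JS']|rewrite SS'].
(* As [J] and [J'] are disjoint, both families are restrictions of a single one, and [E_indep]
   factorises over [J], [J'] and their union. *)
pose A'' i := if i \in J then A i else A' i.
have -> : \bigcap_(i in [set` J]) A i = \bigcap_(i in [set` J]) A'' i.
  by apply: eq_bigcapr => i /= iJ; rewrite /A'' iJ.
have -> : \bigcap_(i in [set` J']) A' i = \bigcap_(i in [set` J']) A'' i.
  apply: eq_bigcapr => i /= iJ'; rewrite /A''; case: ifPn => // iJ.
  by have := JJ' _ iJ; rewrite iJ'.
have EA'' i : E i (A'' i) by rewrite /A''; case: ifP.
rewrite -bigcap_setU.
have -> : [set` J] `|` [set` J'] = [set` (J `|` J')%fset].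
  by apply/seteqP; split => i /=; rewrite inE => /orP.
rewrite !E_indep //.
rewrite (perm_big (enum_fset J ++ enum_fset J')) ?big_cat//=.
apply: uniq_perm; rewrite ?fset_uniq//.
  rewrite cat_uniq !fset_uniq andbT /=; apply/hasPn => i iJ'.
  by apply/negP => iJ; have := JJ' _ iJ; rewrite iJ'.
by move=> i; rewrite mem_cat inE.
Qed.

Definition sigma_of (S : set I) : set (set Omega) := <<s cylinder S >>.

Lemma sigma_of_sub_measurable S : sigma_of S `<=` measurable.
Proof.
apply: smallest_sub; [exact: sigma_algebra_measurable|exact: cylinder_sub_measurable].
Qed.

Lemma cylinderT S : cylinder S setT.
Proof.
exists fset0, (fun=> setT); split => //; first by move=> i; exact: class_setT.
by apply/seteqP; split.
Qed.

(** As functions of [A], both sides are finite measures: [P] restricted to [B], and [P] scaled by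
    [P B]. They agree on a pi-system containing the whole space, hence on what it generates. *)
Lemma indep_extend (G : set (set Omega)) B : measurable B ->
  G `<=` measurable -> setI_closed G -> G setT ->
  (forall A, G A -> P (A `&` B) = (P A * P B)%E) ->
  forall A, <<s G >> A -> P (A `&` B) = (P A * P B)%E.
Proof.
move=> mB Gm GI GT H A sA.
have PB : (0 <= fine (P B))%R by rewrite fine_ge0.
have := @g_sigma_algebra_measure_unique _ R _ G Gm (fun=> setT) (fun=> GT) _
  (mrestr P mB) (mscale (NngNum PB) P) GI _ _ A sA.
rewrite /mrestr/= /mscale/= fineK ?fin_num_measure// muleC; apply.
- by apply/seteqP; split => // x _; exists 0%N.
- by move=> A1 GA1; rewrite muleC -H.
- by move=> _; rewrite /mrestr setTI ltey_eq fin_num_measure.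
Qed.

(** Two applications of [indep_extend]: with [B] fixed, [B'] is reduced to a cylinder; with that
    cylinder fixed, so is [B]. *)
Lemma sigma_of_indep S S' B B' : S `&` S' = set0 ->
  sigma_of S B -> sigma_of S' B' -> P (B `&` B') = (P B * P B')%E.
Proof.
move=> SS' sB sB'.
have mB := sigma_of_sub_measurable sB.
rewrite setIC muleC.
apply: (indep_extend mB _ _ _ _ sB').
- exact: cylinder_sub_measurable.
- exact: cylinder_setI.
- exact: cylinderT.
move=> A cA; rewrite setIC muleC.
apply: (indep_extend _ _ _ _ _ sB).
- exact: cylinder_sub_measurable cA.
- exact: cylinder_sub_measurable.
- exact: cylinder_setI.
- exact: cylinderT.
by move=> A' cA'; exact: cylinder_indep SS' _ _.
Qed.

Lemma sigma_of_class S i B : S i -> E i B -> sigma_of S B.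
Proof.
move=> Si EB; apply: sub_gen_smallest.
exists [fset i]%fset, (fun j => if j == i then B else setT); split.
- by move=> j; case: eqP => [->//|_]; exact: class_setT.
- by move=> j /=; rewrite inE => /eqP->.
- apply/seteqP; split => [w Bw j /=|w /(_ i)/=]; rewrite inE ?eqxx.
    by move=> ->.
  by move=> /(_ isT).
Qed.

Lemma sigma_of_mono S S' : S `<=` S' -> sigma_of S `<=` sigma_of S'.
Proof.
move=> SS'; apply: sub_smallest2r => // _ [J [A [EA JS ->]]].
by exists J, A; split => //; exact: subset_trans SS'.
Qed.

Lemma sigma_of_sigma_algebra S : sigma_algebra setT (sigma_of S).
Proof. exact: smallest_sigma_algebra. Qed.

Lemma sigma_of_setI S A B : sigma_of S A -> sigma_of S B -> sigma_of S (A `&` B).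
Proof. by move=> ? ?; apply: (sigma_algebra_setI (sigma_of_sigma_algebra S)). Qed.

Lemma sigma_ofT S : sigma_of S setT.
Proof. by apply: sub_gen_smallest; exact: cylinderT. Qed.

(** Induction on [L] that absorbs the head event into [B] and its index set into [S0]. In the
    applications [B] describes the past and the [A x] describe disjoint subtrees. *)
Lemma sigma_of_indep_seq {X : choiceType} (L : seq X) (S0 : set I)
    (S : X -> set I) B (A : X -> set Omega) :
  uniq L ->
  (forall x, x \in L -> S0 `&` S x = set0) ->
  (forall x y, x \in L -> y \in L -> x != y -> S x `&` S y = set0) ->
  sigma_of S0 B -> (forall x, x \in L -> sigma_of (S x) (A x)) ->
  P (B `&` \bigcap_(x in [set` L]) A x) = (P B * \prod_(x <- L) P (A x))%E.
Proof.
elim: L S0 B => [|x L IH] S0 B /= uL dS0 dS sB sA.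
  by rewrite set_nil bigcap_set0 setIT big_nil mule1.
case/andP: uL => xL uL.
rewrite bigcap_seq_cons setIA (IH (S0 `|` S x)) //.
- have /sigma_of_indep -> // : S0 `&` S x = set0 by apply: dS0; rewrite mem_head.
    by rewrite big_cons muleA.
  by apply: sA; rewrite mem_head.
- move=> y yL; rewrite setIUl dS0 ?inE ?yL ?orbT// set0U dS ?inE ?eqxx ?yL ?orbT//.
  by apply: contraNneq xL => ->.
- by move=> y z yL zL; apply: dS; rewrite inE ?yL ?zL orbT.
- apply: sigma_of_setI; first by apply: sigma_of_mono sB; exact: subsetUl.
  apply: (@sigma_of_mono (S x)); first exact: subsetUr.
  by apply: sA; rewrite mem_head.
- by move=> y yL; apply: sA; rewrite inE yL orbT.
Qed.

End Independence.

(** * Measurability of discrete functionals *)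

Section DiscreteMeasurability.
Context {Omega : Type}.
Implicit Types F : set (set Omega).

(** Measurability for the discrete sigma-algebra on [T]. The source sigma-algebra [F] is an
    argument, since several sub-sigma-algebras of one [Omega] are in play. *)
Definition discrete_wrt {T : Type} F (X : Omega -> T) :=
  forall B : set T, F (X @^-1` B).

Lemma discrete_wrt_cst {T : Type} F (c : T) : sigma_algebra setT F ->
  discrete_wrt F (fun=> c).
Proof.
move=> [F0 FC FU] B; case: (pselect (B c)) => Bc.
  rewrite (_ : _ @^-1` _ = setT); last by apply/seteqP; split.
  by rewrite -(setD0 setT); exact: FC.
by rewrite (_ : _ @^-1` _ = set0)//; apply/seteqP; split.
Qed.

(** The preimage splits over the countably many values of [X]; codes of no value contribute the
    empty set. *)
Lemma discrete_wrt_bind {T : countType} {T' : Type} F (X : Omega -> T)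
    (Y : T -> Omega -> T') : sigma_algebra setT F ->
  discrete_wrt F X -> (forall t, discrete_wrt F (Y t)) ->
  discrete_wrt F (fun w => Y (X w) w).
Proof.
move=> Fs FX FY B; case: (Fs) => F0 FC FU.
rewrite (_ : _ @^-1` _ = \bigcup_n
  oapp (fun t => X @^-1` [set t] `&` Y t @^-1` B) set0 (unpickle n)).
  apply: FU => n; case: unpickle => [t|] //=.
  by apply: (sigma_algebra_setI Fs); [exact: FX|exact: FY].
apply/seteqP; split => [w /= YB|w [n _]].
  by exists (pickle (X w)) => //; rewrite pickleK.
by case: unpickle => // t [/= ->].
Qed.

Lemma discrete_wrt_comp {T : countType} {T' : Type} F (X : Omega -> T)
    (f : T -> T') : sigma_algebra setT F ->
  discrete_wrt F X -> discrete_wrt F (fun w => f (X w)).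
Proof.
move=> Fs FX; apply: (discrete_wrt_bind (Y := fun t _ => f t) Fs FX) => t.
exact: discrete_wrt_cst.
Qed.

Lemma discrete_wrt_comp2 {T1 T2 : countType} {T' : Type} F (X1 : Omega -> T1)
    (X2 : Omega -> T2) (f : T1 -> T2 -> T') : sigma_algebra setT F ->
  discrete_wrt F X1 -> discrete_wrt F X2 ->
  discrete_wrt F (fun w => f (X1 w) (X2 w)).
Proof.
move=> Fs F1 F2; apply: (discrete_wrt_bind (Y := fun t w => f t (X2 w)) Fs F1) => t.
exact: discrete_wrt_comp.
Qed.

Lemma discrete_wrt_map {T T' : countType} F (s : seq T) (f : T -> Omega -> T') :
  sigma_algebra setT F -> (forall x, x \in s -> discrete_wrt F (f x)) ->
  discrete_wrt F (fun w => [seq f x w | x <- s]).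
Proof.
move=> Fs; elim: s => [|x s IH] H; first exact: discrete_wrt_cst.
apply: discrete_wrt_comp2 => //; first by apply: H; rewrite mem_head.
by apply: IH => y ys; apply: H; rewrite inE ys orbT.
Qed.

Lemma discrete_wrt_mono {T : Type} F F' (X : Omega -> T) :
  F `<=` F' -> discrete_wrt F X -> discrete_wrt F' X.
Proof. by move=> FF' FX B; exact/FF'/FX. Qed.

End DiscreteMeasurability.

(** * Genealogy of the branching random walk *)

Section Genealogy.
Context {dOm : measure_display} {Omega : measurableType dOm} {R : realType}.
Context {P : probability Omega R} {d : nat}.
Variables (offspring : label -> {RV P >-> nat})
          (step : label -> nat -> {RV P >-> site d}).

Definition children (w : Omega) (s : seq label) : seq label :=
  [seq k :: u | u <- s, k <- iota 0 (offspring u w)].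

Definition descendants (j : nat) (u : label) (w : Omega) : seq label :=
  iter j (children w) [:: u].

Lemma generation_iter n w : generation offspring n w = iter n (children w) [:: [::]].
Proof. by elim: n => //= n ->. Qed.

Lemma children_cat w s1 s2 : children w (s1 ++ s2) = children w s1 ++ children w s2.
Proof. by rewrite /children map_cat flatten_cat. Qed.

Lemma iter_children_flatten w j s :
  iter j (children w) s = flatten [seq descendants j u w | u <- s].
Proof.
have iter_nil : iter j (children w) [::] = [::] by elim: j => //= j ->.
have iter_cat s1 s2 :
    iter j (children w) (s1 ++ s2) = iter j (children w) s1 ++ iter j (children w) s2.
  by elim: j {iter_nil} => //= j ->; exact: children_cat.
elim: s => [//|u s IH] /=.
by rewrite -cat1s iter_cat IH.
Qed.

Lemma generationD m j w : generation offspring (m + j) w =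
  flatten [seq descendants j u w | u <- generation offspring m w].
Proof.
by rewrite -iter_children_flatten !generation_iter addnC iterD.
Qed.

Lemma children1 w u :
  children w [:: u] = [seq k :: u | k <- iota 0 (offspring u w)].
Proof. by rewrite /children /= cats0. Qed.

(** [iter] adds the youngest generation last; splitting at the root instead exposes the independent
    subtrees of the children. *)
Lemma descendantsS j u w : descendants j.+1 u w =
  flatten [seq descendants j (k :: u) w | k <- iota 0 (offspring u w)].
Proof. by rewrite /descendants iterSr iter_children_flatten children1 -map_comp. Qed.

Lemma generation_size n w u : u \in generation offspring n w -> size u = n.
Proof.
elim: n u => [|n IH] u; first by rewrite inE => /eqP->.
by move=> /= /allpairsPdep[v [k [/IH <- _ ->]]].
Qed.

Lemma generation_uniq n w : uniq (generation offspring n w).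
Proof.
elim: n => // n IH /=; apply: allpairs_uniq_dep => //.
  by move=> u _; exact: iota_uniq.
by move=> [u k] [v l] /= _ _ [-> ->].
Qed.

(** A displacement belongs to the parent, not to the child that it moves; hence [subtree (k :: u)]
    leaves out the index of [step u k]. *)
Definition owner (i : label + label * nat) : label :=
  match i with inl u => u | inr (u, _) => u end.

(** Labels grow at the head, so the potential descendants of [u] are the labels with suffix [u]. *)
Definition subtree (u : label) : set (label + label * nat) :=
  [set i | suffix u (owner i)].

Definition past (n : nat) : set (label + label * nat) :=
  [set i | (size (owner i) < n)%N].

Lemma subtree_cons k u : subtree (k :: u) `<=` subtree u.
Proof.
by move=> i; rewrite /subtree /=; apply: suffix_trans; exact: suffix_cons.
Qed.

Lemma past_subtree_disjoint u : past (size u) `&` subtree u = set0.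
Proof.
apply/seteqP; split => // i [+ /size_suffix].
by rewrite /past /= ltnNge => /negP.
Qed.

Lemma subtree_disjoint u v : size u = size v -> u != v ->
  subtree u `&` subtree v = set0.
Proof.
move=> uv /eqP neq; apply/seteqP; split => // i [].
by rewrite /subtree /= !suffixE uv => /eqP eu /eqP ev; apply: neq; exact: etrans (esym eu) ev.
Qed.

Local Notation sigma := (sigma_of (driving_sigma offspring step)).

Lemma driving_sigma_measurable i : driving_sigma offspring step i `<=` measurable.
Proof.
case: i => [u|[u k]] _ [B mB <-].
- exact: (measurable_funPT (offspring u)).
- exact: (measurable_funPT (step u k)).
Qed.

Lemma driving_sigma_sigma_algebra i :
  sigma_algebra setT (driving_sigma offspring step i).
Proof.
by case: i => [u|[u k]]; apply: sigma_algebra_preimage; exact: sigma_algebra_measurable.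
Qed.

Let sigmaP S := sigma_of_sigma_algebra (driving_sigma offspring step) S.

Lemma offspring_discrete S u : S (inl u) -> discrete_wrt (sigma S) (offspring u).
Proof.
move=> Su B; apply: (sigma_of_class driving_sigma_sigma_algebra Su).
by exists B => //; rewrite setTI.
Qed.

Lemma step_discrete S u k : S (inr (u, k)) -> discrete_wrt (sigma S) (step u k).
Proof.
move=> Su B; apply: (sigma_of_class driving_sigma_sigma_algebra Su).
by exists B => //; rewrite setTI.
Qed.

Lemma generation_discrete n :
  discrete_wrt (sigma (past n)) (generation offspring n).
Proof.
elim: n => [|n IH]; first exact: discrete_wrt_cst.
(* Discarding the labels of size <> n changes nothing, but makes [children w t]
   measurable with respect to the past for every list t, attained or not. *)
have -> : generation offspring n.+1 = fun w =>
    children w [seq u <- generation offspring n w | size u == n].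
  apply/funext => w; rewrite [RHS](_ : _ = children w (generation offspring n w))//.
  congr children; apply/all_filterP/allP => u /generation_size ->.
  exact: eqxx.
apply: (discrete_wrt_bind (Y := fun t w => children w [seq u <- t | size u == n])) => //.
  apply: discrete_wrt_mono IH; apply: sigma_of_mono => i /=.
  exact: ltnW.
move=> t; apply: (discrete_wrt_comp flatten) => //.
apply: discrete_wrt_map => // u; rewrite mem_filter => /andP[/eqP un _].
apply: (discrete_wrt_comp (fun l => [seq k :: u | k <- iota 0 l])) => //.
by apply: offspring_discrete; rewrite /past /= un.
Qed.

Lemma descendants_discrete j u :
  discrete_wrt (sigma (subtree u)) (descendants j u).
Proof.
elim: j u => [|j IH] u; first exact: discrete_wrt_cst.
have -> : descendants j.+1 u = fun w =>
    flatten [seq descendants j (k :: u) w | k <- iota 0 (offspring u w)].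
  by apply/funext => w; exact: descendantsS.
apply: (discrete_wrt_bind (Y := fun l w =>
  flatten [seq descendants j (k :: u) w | k <- iota 0 l])) => //.
  by apply: offspring_discrete; exact: suffix_refl.
move=> l; apply: (discrete_wrt_comp flatten) => //.
apply: discrete_wrt_map => // k _; apply: discrete_wrt_mono (IH _).
by apply: sigma_of_mono; exact: subtree_cons.
Qed.

Lemma position_discrete u : discrete_wrt measurable (position step u).
Proof.
have sm := @sigma_algebra_measurable _ Omega.
elim: u => [|k u IH] /=; first exact: discrete_wrt_cst.
apply: (discrete_wrt_comp2 (fun x y => x + y) sm IH) => B.
by rewrite -[_ @^-1` _]setTI; exact: (measurable_funPT (step u k)).
Qed.

(** The range [iota 0 b] is deterministic, so only variables of fixed labels occur; once the first
    test succeeds it lists exactly the children born. *)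
Fixpoint frozen_tree (b k : nat) (u : label) (w : Omega) : bool :=
  if k is k'.+1 then (offspring u w == b) &&
    all (fun i => (step u i w == 0) && frozen_tree b k' (i :: u) w) (iota 0 b)
  else true.

Lemma frozen_tree_discrete b k u :
  discrete_wrt (sigma (subtree u)) (frozen_tree b k u).
Proof.
elim: k u => [|k IH] u; first exact: discrete_wrt_cst.
apply: discrete_wrt_comp2 => //.
  apply: (discrete_wrt_comp (fun l => l == b)) => //.
  by apply: offspring_discrete; exact: suffix_refl.
have -> : (fun w => all (fun i => (step u i w == 0) && frozen_tree b k (i :: u) w)
      (iota 0 b)) = (fun w => all id
    [seq (step u i w == 0) && frozen_tree b k (i :: u) w | i <- iota 0 b]).
  by apply/funext => w; rewrite all_map.
apply: (discrete_wrt_comp (all id)) => //.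
apply: discrete_wrt_map => // i _; apply: discrete_wrt_comp2 => //.
  apply: (discrete_wrt_comp (fun x => x == 0)) => //.
  by apply: step_discrete; exact: suffix_refl.
apply: discrete_wrt_mono (IH _).
by apply: sigma_of_mono; exact: subtree_cons.
Qed.

Lemma frozen_tree_count b k u w : frozen_tree b k u w ->
  count (fun v => position step v w == position step u w) (descendants k u w) = (b ^ k)%N.
Proof.
elim: k u => [|k IH] u; first by rewrite /= eqxx.
rewrite [frozen_tree _ _ _ _]/= => /andP[] /eqP offb /allP H.
rewrite descendantsS offb count_flatten -map_comp.
rewrite (_ : [seq _ | i <- _] = [seq (b ^ k)%N | i <- iota 0 b]); last first.
  apply/eq_in_map => i /H /andP[/eqP st0 /IH <-] /=.
  by rewrite st0 addr0.
have sum_cst c (s : seq nat) : sumn [seq c | _ <- s] = (size s * c)%N.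
  by elim: s => //= _ s ->; rewrite mulSn.
by rewrite sum_cst size_iota expnS.
Qed.

(** The descendants of the other particles of generation [m] can only increase the count at that
    site. *)
Lemma frozen_tree_U b k m u w : u \in generation offspring m w ->
  frozen_tree b k u w -> (b ^ k <= U offspring step (m + k) (position step u w) w)%N.
Proof.
move=> um /frozen_tree_count <-; rewrite /U generationD.
case/splitPr: um => s1 s2.
rewrite map_cat /= flatten_cat /= !count_cat addnCA.
exact: leq_addr.
Qed.

End Genealogy.

(** * Branching property *)

Section OffspringLaw.
Context {R : realType}.
Variable Q : probability nat R.

Definition pgf (s : R) : R := fine 'E_Q[fun l : nat => s ^+ l].

Lemma discrete_expectation (f : nat -> R) : (forall l, 0 <= f l) ->
  ('E_Q[f] = \sum_(0 <= l <oo) Q [set l] * (f l)%:E)%E.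
Proof.
move=> f0; rewrite unlock.
have <- : \bigcup_l [set l] = [set: nat] by apply/seteqP; split => // l _; exists l.
rewrite ge0_integral_bigcup //.
- apply: eq_eseriesr => l _.
  rewrite (eq_integral (cst (f l)%:E)); last by move=> x; rewrite inE => ->.
  by rewrite integral_cst// muleC.
- by move=> l _ /=; rewrite lee_fin.
- by move=> i j _ _ [x [-> ->]].
Qed.

Lemma expectation_ge0_le1 (f : nat -> R) : (forall l, 0 <= f l <= 1) ->
  (0 <= 'E_Q[f] <= 1)%E.
Proof.
move=> f01; apply/andP; split.
  by apply: expectation_ge0 => l; case/andP: (f01 l).
rewrite -(expectation_cst Q 1) !unlock; apply: ge0_le_integral => //.
- by move=> l _; rewrite lee_fin; case/andP: (f01 l).
- by move=> l _; rewrite lee_fin; case/andP: (f01 l).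
Qed.

Lemma exprn_unit_itv (s : R) l : 0 <= s <= 1 -> 0 <= s ^+ l <= 1.
Proof. by case/andP => s0 s1; rewrite exprn_ge0// exprn_ile1. Qed.

Lemma pgfE s : 0 <= s <= 1 ->
  'E_Q[fun l : nat => (s ^+ l)%R]%E = (pgf s)%:E.
Proof.
move=> s01; have /andP[E0 E1] : (0 <= 'E_Q[fun l : nat => (s ^+ l)%R] <= 1)%E.
  by apply: expectation_ge0_le1 => l; exact: exprn_unit_itv.
by rewrite /pgf fineK// ge0_fin_numE// (le_lt_trans E1)// ltry.
Qed.

Lemma pgf_unit_itv s : 0 <= s <= 1 -> 0 <= pgf s <= 1.
Proof.
move=> s01; rewrite -!lee_fin -pgfE//.
by apply: expectation_ge0_le1 => l; exact: exprn_unit_itv.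
Qed.

(** Iterates of the generating function at 0; [extinct_prob] identifies them with the probabilities
    of having no descendants after [n] generations. *)
Definition extinction (n : nat) : R := iter n pgf 0.

Lemma extinction_unit_itv n : 0 <= extinction n <= 1.
Proof. by elim: n => [|n IH] /=; [rewrite lexx ler01|exact: pgf_unit_itv]. Qed.

Fixpoint frozen_tree_prob (d b k : nat) : R :=
  if k is k'.+1 then
    fine (Q [set b]) * ((2 * d + 1)%N%:R^-1 * frozen_tree_prob d b k') ^+ b
  else 1.

End OffspringLaw.

(** * Decomposition over the values of a discrete variable *)

Section CountablePartition.
Context {dOm : measure_display} {Omega : measurableType dOm} {R : realType}.
Variable P : probability Omega R.

Lemma countable_partition {T : countType} (X : Omega -> T) (D : set Omega) :
  discrete_wrt measurable X -> measurable D ->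
  P D = (\sum_(0 <= n <oo) P (D `&` [set w | pickle (X w) = n]))%E.
Proof.
move=> mX mD.
have mn n : measurable (D `&` [set w | pickle (X w) = n]).
  apply: measurableI => //; exact: (mX [set t | pickle t = n]).
rewrite -measure_semi_bigcup //.
- congr (P _); apply/seteqP; split => [w Dw|w [n _ []]//].
  by exists (pickle (X w)).
- by move=> i j _ _ [w [[_ /= <-] [_ /= <-]]].
- exact: bigcup_measurable.
Qed.

(** Sums fibrewise inequalities over the values of [X], which takes the place of conditioning on
    [X]. *)
Lemma countable_partition_le {T : countType} (X : Omega -> T) (D D' : set Omega)
    (c c' : R) : discrete_wrt measurable X -> measurable D -> measurable D' ->
  0 <= c -> 0 <= c' ->
  (forall t, (c%:E * P (D `&` [set w | X w = t]) <=
     c'%:E * P (D' `&` [set w | X w = t]))%E) ->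
  (c%:E * P D <= c'%:E * P D')%E.
Proof.
move=> mX mD mD' c0 c0' H.
rewrite (countable_partition mX mD) (countable_partition mX mD').
rewrite -!nneseriesZl //.
apply: lee_nneseries => [n _ _|n _]; first by rewrite mule_ge0 ?lee_fin.
case: (pselect (exists t : T, pickle t = n)) => [[t <-]|nt].
  rewrite (_ : [set w | _] = [set w | X w = t])//.
  by apply/seteqP; split => w /= => [/(pcan_inj pickleK)|->].
have -> : [set w | pickle (X w) = n] = set0.
  by apply/seteqP; split => // w /= Xw; apply: nt; exists (X w).
by rewrite !setI0 !measure0 !mule0.
Qed.

End CountablePartition.

(** * Probabilities computed by a decomposition at the root *)

Section BranchingProbabilities.
Context {dOm : measure_display} {Omega : measurableType dOm} {R : realType}.
Context {P : probability Omega R} {d : nat}.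
Context {offspring : label -> {RV P >-> nat}}
        {step : label -> nat -> {RV P >-> site d}}.
Context {Q : probability nat R}.
Hypothesis brw : is_brw offspring step Q.

Local Notation sigma := (sigma_of (driving_sigma offspring step)).

Let sigma_measurable S : sigma S `<=` measurable.
Proof.
by apply: sigma_of_sub_measurable; exact: driving_sigma_measurable.
Qed.

Let indep2 := sigma_of_indep (@driving_sigma_measurable _ _ _ _ _ offspring step)
  (@driving_sigma_sigma_algebra _ _ _ _ _ offspring step) (brw_indep brw).

Let indep_seq X := @sigma_of_indep_seq _ _ _ _ _ _
  (@driving_sigma_measurable _ _ _ _ _ offspring step)
  (@driving_sigma_sigma_algebra _ _ _ _ _ offspring step) (brw_indep brw) X.

Lemma offspring_prob u l : P [set w | offspring u w = l] = Q [set l].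
Proof. by rewrite -(brw_offspring brw u). Qed.

(** The offspring number of [u] and, for each [k], the displacement and the subtree of the [k]-th
    child involve pairwise disjoint sets of driving variables. *)
Lemma children_indep u l (F : nat -> set Omega) (a : R) :
  (forall k, (k < l)%N -> sigma (inr (u, k) |` subtree (k :: u)) (F k)) ->
  (forall k, (k < l)%N -> P (F k) = a%:E) ->
  P ([set w | offspring u w = l] `&` \bigcap_(k in [set` iota 0 l]) F k) =
  (Q [set l] * (a ^+ l)%:E)%E.
Proof.
move=> sF PF.
rewrite (indep_seq (S0 := [set inl u]) (S := fun k => inr (u, k) |` subtree (k :: u))).
- rewrite offspring_prob; congr (_ * _)%E.
  rewrite big_seq (eq_bigr (fun=> a%:E)); last first.
    by move=> k; rewrite mem_iota => /andP[_ kl]; exact: PF.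
  rewrite -big_seq prodEFin; congr (_%:E).
  by rewrite big_const_seq count_predT size_iota iter_mulr_1.
- exact: iota_uniq.
- move=> k _; apply/seteqP; split => // i [->] [//|].
  by rewrite /subtree /= => /size_suffix; rewrite ltnn.
- move=> k k' _ _ kk'; have kk1 : k :: u != k' :: u by rewrite eqseq_cons (negPf kk').
  have := subtree_disjoint (erefl : size (k :: u) = size (k' :: u)) kk1 => dis.
  apply/seteqP; split => // i [[->|i1] [|i2]].
  + by case=> kE; rewrite kE eqxx in kk'.
  + by move: i2; rewrite /subtree /= => /size_suffix; rewrite ltnn.
  + by move=> iE; move: i1; rewrite iE /subtree /= => /size_suffix; rewrite ltnn.
  + by rewrite -dis; split.
- exact: (offspring_discrete (S := [set inl u]) (erefl _) [set l]).
- by move=> k; rewrite mem_iota => /andP[_ kl]; exact: sF.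
Qed.

(** Given [l] children, the progeny is extinct when all [l] subtrees are, with probability
    [extinction Q j ^+ l]; summing over [l] produces the generating function. *)
Lemma extinct_prob j u :
  P [set w | descendants offspring j u w = [::]] = (extinction Q j)%:E.
Proof.
elim: j u => [|j IH] u.
  rewrite (_ : [set w | _] = set0) ?measure0//.
  by apply/seteqP; split.
rewrite (@countable_partition _ _ _ P _ (offspring u)); last 2 first.
- move=> B; rewrite -[_ @^-1` _]setTI; exact: (measurable_funPT (offspring u)).
- by apply: sigma_measurable; exact: (descendants_discrete j.+1 [set [::]]).
rewrite /extinction iterS -/(extinction Q j) -pgfE ?extinction_unit_itv//.
rewrite discrete_expectation; last first.
  by move=> l; rewrite exprn_ge0//; case/andP: (extinction_unit_itv Q j).
apply: eq_eseriesr => l _.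
rewrite -(children_indep (u := u)
  (F := fun k => [set w | descendants offspring j (k :: u) w = [::]])) //.
- congr (P _); apply/seteqP; split => w.
    case; rewrite /mkset descendantsS => des ol; split => // k /= kl.
    have {}ol : offspring u w = l := ol.
    (* The sizes of the sublists sum to 0, so each of them is 0. *)
    apply/nilP; rewrite /nilp -leqn0 -[leqRHS]/(size (Nil label)) -des size_flatten /shape.
    move: kl; rewrite -map_comp ol => kl.
    by case/splitPr: kl => s1 s2; rewrite map_cat sumn_cat /= addnCA leq_addr.
  move=> [ol H]; split => //; rewrite /mkset descendantsS ol.
  elim: (iota 0 l) H => //= k s IHs H.
  have -> : descendants offspring j (k :: u) w = [::] := H k (mem_head _ _).
  apply: IHs => k' /= k's.
  by apply: H; rewrite /= inE k's orbT.
- move=> k _; apply: (sigma_of_mono (S := subtree (k :: u))); first exact: subsetUr.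
  exact: (descendants_discrete j [set [::]]).
Qed.

Lemma step0_prob u k : P [set w | step u k w = 0] = ((2 * d + 1)%N%:R^-1)%:E.
Proof.
have := brw_step brw u k 0.
rewrite (_ : lattice_dist 0 0 = 0) ?ler01//.
by rewrite /lattice_dist big1// => i _; rewrite subrr normr0.
Qed.

Lemma frozen_tree_probE b k u :
  P [set w | frozen_tree offspring step b k u w] = (frozen_tree_prob Q d b k)%:E.
Proof.
elim: k u => [|k IH] u.
  by rewrite (_ : [set w | _] = setT) ?probability_setT//; apply/seteqP; split.
rewrite [frozen_tree_prob _ _ _ _]/= EFinM fineK ?fin_num_measure//.
rewrite -(children_indep (u := u) (F := fun i => [set w | step u i w = 0] `&`
  [set w | frozen_tree offspring step b k (i :: u) w])).
- congr (P _); apply/seteqP; split => w /=.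
    case/andP => /eqP ob /allP H; split => // i /= /H /andP[/eqP s0 ft].
    by split.
  move=> [ob H]; rewrite ob eqxx /=; apply/allP => i ib.
  by have [/= -> ->] := H i ib; rewrite eqxx.
- move=> i _; apply: sigma_of_setI.
    apply: (step_discrete _ [set 0]); by left.
  apply: (sigma_of_mono (S := subtree (i :: u))); first exact: subsetUr.
  exact: (frozen_tree_discrete b k [set true]).
- move=> i _.
  (* The displacement of child [i] is owned by [u], hence independent of the subtree of [i]. *)
  rewrite (indep2 (S := [set inr (u, i)]) (S' := subtree (i :: u))).
  + by rewrite step0_prob IH EFinM.
  + apply/seteqP; split => // x [->].
    by rewrite /subtree /= => /size_suffix; rewrite ltnn.
  + exact: (step_discrete _ [set 0]).
  + exact: (frozen_tree_discrete b k [set true]).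
Qed.

End BranchingProbabilities.

(** * Independence of the subtrees given a generation *)

Section BranchingProperty.
Context {dOm : measure_display} {Omega : measurableType dOm} {R : realType}.
Context {P : probability Omega R} {d : nat}.
Context {offspring : label -> {RV P >-> nat}}
        {step : label -> nat -> {RV P >-> site d}}.
Context {Q : probability nat R}.
Hypothesis brw : is_brw offspring step Q.

Local Notation sigma := (sigma_of (driving_sigma offspring step)).

Let sigma_measurable S : sigma S `<=` measurable.
Proof.
by apply: sigma_of_sub_measurable; exact: driving_sigma_measurable.
Qed.

Lemma generation_measurable n : discrete_wrt measurable (generation offspring n).
Proof. by move=> B; apply: (@sigma_measurable (past n)); exact: generation_discrete. Qed.

(** An event attached to each label, determined by its subtree and of common probability [a]. It is
    used for extinction after [j] generations and for the absence of a frozen tree. *)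
Variables (F : label -> Omega -> bool) (a : R).
Hypothesis F_discrete : forall u, discrete_wrt (sigma (subtree u)) (F u).
Hypothesis F_prob : forall u, P [set w | F u w] = a%:E.

Lemma all_generation_measurable m :
  measurable [set w | all (F^~ w) (generation offspring m w)].
Proof.
suff : discrete_wrt measurable (fun w => all (F^~ w) (generation offspring m w)).
  exact.
have sm := sigma_algebra_measurable Omega.
apply: (discrete_wrt_bind (Y := fun L w => all (F^~ w) L) sm (generation_measurable m)) => L.
have -> : (fun w => all (F^~ w) L) = (fun w => all id [seq F u w | u <- L]).
  by apply/funext => w; rewrite all_map.
apply: (discrete_wrt_comp (all id) sm); apply: discrete_wrt_map => // u _.
by move=> B; apply: sigma_measurable; exact: F_discrete.
Qed.

(** Once generation [m] is a fixed list [L], the event is an intersection of [size L] subtree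
    events, independent of each other and of the past. *)
Lemma branching_fiber m (L : seq label) :
  P ([set w | all (F^~ w) (generation offspring m w)] `&`
     [set w | generation offspring m w = L]) =
  (P [set w | generation offspring m w = L] * (a ^+ size L)%:E)%E.
Proof.
(* A list with repetitions, or with a label of length other than [m], is never a generation, and
   both sides vanish. *)
have [/andP[uL /allP sL]|bad] := boolP (uniq L && all (fun u => size u == m) L); last first.
  have -> : [set w | generation offspring m w = L] = set0.
    apply/seteqP; split => // w /= gL; move: bad; rewrite -gL generation_uniq /=.
    by apply/negP; rewrite negbK; apply/allP => u /generation_size ->.
  by rewrite setI0 measure0 mul0e.
have -> : [set w | all (F^~ w) (generation offspring m w)] `&`
    [set w | generation offspring m w = L] =
    [set w | generation offspring m w = L] `&` \bigcap_(u in [set` L]) [set w | F u w].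
  apply/seteqP; split => w /= [].
    by move=> /allP H gL; split => // u /= uL'; apply: H; rewrite gL.
  by move=> gL H; split => //; rewrite gL; apply/allP => u; exact: H.
rewrite (sigma_of_indep_seq (@driving_sigma_measurable _ _ _ _ _ offspring step)
  (@driving_sigma_sigma_algebra _ _ _ _ _ offspring step) (brw_indep brw)
  (S0 := past m) (S := subtree)) //.
- congr (_ * _)%E; rewrite (eq_bigr (fun=> a%:E)); last by move=> u _.
  by rewrite prodEFin big_const_seq count_predT iter_mulr_1.
- by move=> u /sL /eqP <-; exact: past_subtree_disjoint.
- move=> u v /sL /eqP su /sL /eqP sv uv; apply: subtree_disjoint => //.
  by rewrite su sv.
- exact: (generation_discrete [set L]).
- by move=> u _; exact: (@F_discrete u [set true]).
Qed.

Hypothesis a01 : 0 <= a <= 1.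

Let size_measurable m (B : set nat) :
  measurable [set w | B (size (generation offspring m w))].
Proof. exact: (generation_measurable m [set L | B (size L)]). Qed.

(** On each fibre the factor is [a ^+ size L], nonincreasing in the size because [a <= 1]; large
    generations thus give an upper bound, and small ones the reverse bound of [branching_ge]. *)
Lemma branching_le m K :
  (P ([set w | (K <= size (generation offspring m w))%N] `&`
      [set w | all (F^~ w) (generation offspring m w)]) <= (a ^+ K)%:E)%E.
Proof.
have /andP[a0 a1] := a01.
apply: (@le_trans _ _ ((a ^+ K)%:E * P setT)%E); last by rewrite probability_setT mule1.
rewrite -[leLHS]mul1e.
apply: (countable_partition_le (X := generation offspring m)) => //.
- exact: generation_measurable.
- apply: measurableI; last exact: all_generation_measurable.
  exact: (size_measurable m [set n | (K <= n)%N]).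
- by rewrite exprn_ge0.
move=> L; rewrite mul1e setTI -setIA.
have [KL|LK] := leqP K (size L); last first.
  rewrite (_ : _ `&` _ = set0) ?measure0 ?mule_ge0 ?lee_fin ?exprn_ge0//.
  apply/seteqP; split => // w /= [+ [_ gL]].
  by rewrite gL leqNgt LK.
apply: (@le_trans _ _ (P ([set w | all (F^~ w) (generation offspring m w)] `&`
     [set w | generation offspring m w = L]))).
  apply: le_measure; rewrite ?inE.
  - apply: measurableI; first exact: (size_measurable m [set n | (K <= n)%N]).
    apply: measurableI; first exact: all_generation_measurable.
    exact: (generation_measurable m [set L]).
  - apply: measurableI; first exact: all_generation_measurable.
    exact: (generation_measurable m [set L]).
  - exact: subIsetr.
rewrite branching_fiber muleC lee_wpmul2r//.
by rewrite lee_fin ler_wiXn2l.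
Qed.

Lemma branching_ge m K :
  ((a ^+ K)%:E * P [set w | (0 < size (generation offspring m w) <= K)%N] <=
   P ([set w | (0 < size (generation offspring m w) <= K)%N] `&`
      [set w | all (F^~ w) (generation offspring m w)]))%E.
Proof.
have /andP[a0 a1] := a01.
rewrite -[leRHS]mul1e.
apply: (countable_partition_le (X := generation offspring m)) => //.
- exact: generation_measurable.
- exact: (size_measurable m [set n | (0 < n <= K)%N]).
- apply: measurableI; last exact: all_generation_measurable.
  exact: (size_measurable m [set n | (0 < n <= K)%N]).
- by rewrite exprn_ge0.
move=> L; rewrite mul1e -setIA.
have [LK|LK] := boolP (0 < size L <= K)%N; last first.
  rewrite (_ : [set w | (_ < _ <= _)%N] `&` [set w | _ = L] = set0) ?measure0 ?mule0//.
  apply/seteqP; split => // w /= [+ gL].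
  by rewrite gL (negPf LK).
have sub (A : set Omega) : A `<=` [set w | generation offspring m w = L] ->
    [set w | (0 < size (generation offspring m w) <= K)%N] `&` A = A.
  by move=> AL; apply/setIidPr => w /AL /= ->.
rewrite !sub//.
rewrite branching_fiber muleC lee_wpmul2l//.
by rewrite lee_fin ler_wiXn2l//; case/andP: LK.
Qed.

End BranchingProperty.

(** * Survival probabilities of critical processes *)

Section CriticalPgf.
Context {R : realType}.
Variable Q : probability nat R.

Local Notation mean f := ('E_Q[(f)%R])%E.

Lemma mean_le (f g : nat -> R) : (forall l, 0 <= f l) ->
  (forall l, f l <= g l) -> (mean f <= mean g)%E.
Proof.
move=> f0 fg; rewrite !unlock; apply: ge0_le_integral => //.
- by move=> l _; rewrite lee_fin.
- by move=> l _; rewrite lee_fin.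
Qed.

Lemma mean_add (f g : nat -> R) : (forall l, 0 <= f l) -> (forall l, 0 <= g l) ->
  (mean (fun l => (f l + g l)%R) = mean f + mean g)%E.
Proof.
move=> f0 g0; rewrite !unlock -ge0_integralD//.
- by move=> l _; rewrite lee_fin.
- by move=> l _; rewrite lee_fin.
Qed.

Lemma mean_scale (k : R) (f : nat -> R) : 0 <= k -> (forall l, 0 <= f l) ->
  (mean (fun l => (k * f l)%R) = k%:E * mean f)%E.
Proof.
move=> k0 f0; rewrite !unlock -ge0_integralZl//.
by move=> l _; rewrite lee_fin.
Qed.

Lemma mean_mass (b : nat) : mean (fun l => (l == b)%:R) = Q [set b].
Proof.
rewrite unlock -[X in Q X]setIT -integral_indic//.
by apply: eq_integral => l _; rewrite indicE;
by case: eqP => lb; [rewrite mem_set|rewrite memNset].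
Qed.

Lemma mean_cst1 : mean (fun=> 1) = 1%E.
Proof. by rewrite (_ : (fun=> _) = cst 1)// expectation_cst. Qed.

Lemma pgf_le s t : 0 <= s -> s <= t -> t <= 1 -> pgf Q s <= pgf Q t.
Proof.
move=> s0 st t1.
rewrite -lee_fin -!pgfE ?(le_trans s0)// ?s0 ?(le_trans st)//.
apply: mean_le => l; first by rewrite exprn_ge0.
by rewrite lerXn2r// nnegrE (le_trans s0).
Qed.

Hypothesis mean1 : ('E_Q[fun l : nat => l%:R : R] = 1)%E.

Lemma variance_mean1 :
  'V_Q[fun l : nat => l%:R : R] = mean (fun l => (l%:R - 1) ^+ 2).
Proof.
by rewrite /variance unlock mean1 /=; congr (expectation _ _).
Qed.

(** Otherwise E[l(l-1)] = 0, and the identity (l-1)^2 + l = 1 + l(l-1) together with mean 1 forces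
    the variance to vanish. The identity is arranged so that only nonnegative functions are
    integrated. *)
Lemma exists_branching : (0 < 'V_Q[fun l : nat => l%:R : R])%E ->
  exists2 b, (2 <= b)%N & 0 < fine (Q [set b]).
Proof.
rewrite variance_mean1 => var_gt0.
have [//|nob] := pselect (exists2 b, (2 <= b)%N & 0 < fine (Q [set b])).
have : (mean (fun l => ((l%:R - 1) ^+ 2 + l%:R : R)%R) =
        mean (fun l => (1 + l%:R * l.-1%:R : R)%R))%E.
  congr (expectation _ _); apply/funext => -[|l] /=; first by ring.
  by rewrite -natr1; ring.
rewrite !mean_add; try by move=> l; rewrite ?sqr_ge0 ?mulr_ge0.
rewrite mean1 mean_cst1 [X in _ = (_ + X)%E]discrete_expectation; last first.
  by move=> l; rewrite mulr_ge0.
rewrite eseries0 ?adde0; last first.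
  move=> [|[|l]] _ _; rewrite ?mulr0 ?mul0r ?mule0//.
  rewrite (_ : Q _ = 0%E) ?mul0e//.
  apply/eqP; rewrite eq_le measure_ge0 andbT -(@fineK _ (Q _)) ?fin_num_measure//.
  by rewrite lee_fin leNgt; apply/negP => q; apply: nob; exists l.+2.
move: var_gt0; case: (mean (fun l => ((l%:R - 1) ^+ 2)%R)) => //= r.
by rewrite lte_fin => r0 [] /eqP; rewrite -subr_eq0 addrK => /eqP rE; rewrite rE ltxx in r0.
Qed.

Lemma pow_lower (b l : nat) (p : R) : (2 <= b)%N -> 0 <= p <= 1 ->
  1 + p ^+ 2 * (l == b)%:R <= (1 - p) ^+ l + p * l%:R.
Proof.
move=> b2 /andP[p0 p1].
have H n : 1 + p ^+ 2 * (2 <= n)%:R <= (1 - p) ^+ n + p * n%:R.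
  elim: n => [|[|n] IH]; rewrite ?expr0 ?expr1 /=; [lra|lra|].
  rewrite (exprS (1 - p)) -(natr1 n.+1).
  have n0 : 0 <= n%:R :> R by [].
  case: n IH n0 => [|n] IH n0; first by rewrite expr1; nra.
  move: IH; rewrite mulr1 -(natr1 n.+1) -(natr1 n).
  have := ler0n R n; set x := n%:R; set y := (1 - p) ^+ _ => x0 IH.
  have : (1 - p) * (1 + p ^+ 2) <= (1 - p) * (y + p * (x + 1 + 1)).
    by apply: ler_wpM2l => //; lra.
  have : 0 <= p ^+ 2 * (1 - p) by rewrite mulr_ge0 ?sqr_ge0//; lra.
  have : 0 <= p ^+ 2 * x by rewrite mulr_ge0 ?sqr_ge0.
  have := sqr_ge0 p.
  lra.
apply: le_trans (H l); rewrite lerD2l ler_wpM2l ?sqr_ge0// ler_nat.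
by case: eqP => // ->; rewrite b2.
Qed.

(** For l >= 1 this follows from the second-order bound with coefficient l(l-1)/2, which is at most
    (l-1)^2. Under mean 1 the square integrates to the variance. *)
Lemma pow_upper (l : nat) (p : R) : 0 <= p <= 1 ->
  (1 - p) ^+ l + p * l%:R <= 1 + p ^+ 2 * (l%:R - 1) ^+ 2.
Proof.
move=> /andP[p0 p1].
have H n : (1 - p) ^+ n.+1 + p * n.+1%:R <= 1 + p ^+ 2 * (n%:R * (n%:R + 1) / 2).
  elim: n => [|n IH]; first by rewrite expr1; lra.
  rewrite (exprS (1 - p)) -natr1.
  have : (1 - p) * ((1 - p) ^+ n.+1 + p * n.+1%:R) <=
         (1 - p) * (1 + p ^+ 2 * (n%:R * (n%:R + 1) / 2)).
    by apply: ler_wpM2l => //; lra.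
  have := ler0n R n; rewrite -!(natr1 n); set x := n%:R; set y := (1 - p) ^+ _ => x0.
  have : 0 <= p * (p ^+ 2 * (x * (x + 1) / 2)).
    by rewrite !mulr_ge0 ?sqr_ge0//; lra.
  nra.
case: l => [|l]; first by rewrite expr0; have := sqr_ge0 p; nra.
apply: le_trans (H l) _; rewrite lerD2l ler_wpM2l ?sqr_ge0//.
case: l => [|l]; first by lra.
by rewrite -(natr1 l.+1) -!(natr1 l); have := ler0n R l; set x := l%:R => x0; nra.
Qed.

Lemma pgf_lower b p : (2 <= b)%N -> 0 <= p <= 1 ->
  1 - p + fine (Q [set b]) * p ^+ 2 <= pgf Q (1 - p).
Proof.
move=> b2 p01; have /andP[p0 p1] := p01.
have q01 : 0 <= 1 - p <= 1 by lra.
have /andP[q0 _] := q01.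
have := @mean_le (fun l => 1 + p ^+ 2 * (l == b)%:R)
  (fun l => (1 - p) ^+ l + p * l%:R) _ (fun l => pow_lower l b2 p01).
rewrite mean_add; last 2 first.
- by [].
- by move=> l; rewrite mulr_ge0 ?sqr_ge0.
rewrite mean_cst1 mean_scale ?sqr_ge0// mean_mass mean_add; last 2 first.
- by move=> l; rewrite exprn_ge0.
- by move=> l; rewrite mulr_ge0.
rewrite mean_scale// mean1 pgfE// mule1 -(@fineK _ (Q [set b])) ?fin_num_measure//.
rewrite -EFinM -!EFinD lee_fin => H.
have : 1 + p ^+ 2 * fine (Q [set b]) <= pgf Q (1 - p) + p.
  by apply: H => l; rewrite addr_ge0// mulr_ge0// sqr_ge0.
lra.
Qed.

Hypothesis var_fin : ('V_Q[fun l : nat => l%:R : R] < +oo)%E.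

Let s2 := fine 'V_Q[fun l : nat => l%:R : R].

Lemma pgf_upper p : 0 <= p <= 1 -> pgf Q (1 - p) <= 1 - p + s2 * p ^+ 2.
Proof.
move=> p01; have /andP[p0 p1] := p01.
have q01 : 0 <= 1 - p <= 1 by lra.
have /andP[q0 _] := q01.
have := @mean_le (fun l => (1 - p) ^+ l + p * l%:R)
  (fun l => 1 + p ^+ 2 * (l%:R - 1) ^+ 2) _ (fun l => pow_upper l p01).
rewrite mean_add; last 2 first.
- by move=> l; rewrite exprn_ge0.
- by move=> l; rewrite mulr_ge0.
rewrite mean_scale// mean1 pgfE// mule1 mean_add; last 2 first.
- by [].
- by move=> l; rewrite mulr_ge0 ?sqr_ge0.
rewrite mean_cst1 mean_scale ?sqr_ge0//; last by move=> l; rewrite sqr_ge0.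
rewrite -variance_mean1.
have -> : 'V_Q[fun l : nat => l%:R : R]%E = s2%:E.
  by rewrite /s2 fineK// ge0_fin_numE// variance_mean1 expectation_ge0// => l; rewrite sqr_ge0.
rewrite -EFinM -!EFinD lee_fin => H.
have : pgf Q (1 - p) + p <= 1 + p ^+ 2 * s2.
  by apply: H => l; rewrite addr_ge0 ?exprn_ge0 ?mulr_ge0.
lra.
Qed.

Definition survival_prob n : R := 1 - extinction Q n.

Lemma survival_prob0 : survival_prob 0 = 1.
Proof. by rewrite /survival_prob /= subr0. Qed.

Lemma survival_prob_unit_itv n : 0 <= survival_prob n <= 1.
Proof. by rewrite /survival_prob; have := extinction_unit_itv Q n; lra. Qed.

Lemma survival_probS n : survival_prob n.+1 = 1 - pgf Q (1 - survival_prob n).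
Proof. by rewrite /survival_prob subKr. Qed.

Lemma survival_prob_decr n : survival_prob n.+1 <= survival_prob n.
Proof.
(* The quadratic term is nonnegative, so b = 2 serves even when [Q [set 2]] is 0. *)
have := @pgf_lower 2 (survival_prob n) isT (survival_prob_unit_itv n).
rewrite survival_probS.
have : 0 <= fine (Q [set 2%N]) * survival_prob n ^+ 2 by rewrite mulr_ge0 ?fine_ge0 ?sqr_ge0.
lra.
Qed.

Lemma survival_prob_le m n : (m <= n)%N -> survival_prob n <= survival_prob m.
Proof.
move/subnKC => <-; elim: (n - m)%N => [|k IH]; first by rewrite addn0.
by rewrite addnS (le_trans (survival_prob_decr _)).
Qed.

(** A division-free form of 1/p_(n+1) >= 1/p_n + c, which comes from p_(n+1) <= p_n (1 - c p_n). *)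
Lemma survival_prob_upper b n : (2 <= b)%N ->
  survival_prob n * (1 + fine (Q [set b]) * n%:R) <= 1.
Proof.
move=> b2; set c := fine _.
have c0 : 0 <= c by rewrite fine_ge0.
have c1 : c <= 1.
  by rewrite -lee_fin fineK ?fin_num_measure// probability_le1.
elim: n => [|n IH]; first by rewrite survival_prob0; lra.
have := pgf_lower b2 (survival_prob_unit_itv n).
rewrite -/c survival_probS -natr1.
have /andP[] := survival_prob_unit_itv n.
move: IH; set p := survival_prob n; set x := n%:R => IH p0 p1 H.
have x0 : 0 <= x by [].
have cp : c * p <= 1 by rewrite mulr_ile1.
apply: (@le_trans _ _ ((p - c * p ^+ 2) * (1 + c * (x + 1)))).
  rewrite ler_wpM2r//; last by lra.
  by rewrite addr_ge0// mulr_ge0// addr_ge0.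
have : p * (1 + c * x) * (1 - c * p) <= 1 * (1 - c * p).
  by rewrite ler_wpM2r//; lra.
have : 0 <= (c * p) ^+ 2 by rewrite sqr_ge0.
nra.
Qed.

(** The sequence a/(n+1) is a subsolution of the recursion: with u = a/(n+1), the condition on [a]
    gives u - s2 u^2 >= a/(n+2). Monotonicity of the generating function carries the comparison
    along. *)
Lemma survival_prob_lower a n : 0 <= a <= 1 -> 2 * s2 * a <= 1 ->
  a / n.+1%:R <= survival_prob n.
Proof.
move=> a01 sa; have /andP[a0 a1] := a01.
elim: n => [|n IH]; first by rewrite survival_prob0 divr1.
have n1 : 0 < n.+1%:R :> R by [].
have t0 : 0 <= a / n.+1%:R by rewrite divr_ge0.
have t1 : a / n.+1%:R <= 1.
  by rewrite ler_pdivrMr// mul1r (le_trans a1)// ler1n.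
have /andP[p0 p1] := survival_prob_unit_itv n.
have : pgf Q (1 - survival_prob n) <= pgf Q (1 - a / n.+1%:R).
  apply: pgf_le; rewrite ?lerD2l ?lerN2 ?subr_ge0 ?gerBl//.
  by case/andP: (extinction_unit_itv Q n).
have := pgf_upper (p := a / n.+1%:R); rewrite t0 t1 => /(_ isT).
rewrite survival_probS.
suff : a / n.+2%:R <= a / n.+1%:R - s2 * (a / n.+1%:R) ^+ 2.
  by set u := a / n.+1%:R; set v := a / n.+2%:R => *; lra.
rewrite -[n.+2%:R]natr1; move: n1 sa; set x := n.+1%:R => n1 sa.
have x1 : 1 <= x by rewrite ler1n.
rewrite -subr_ge0.
rewrite (_ : _ - _ = a * (x - s2 * a * (x + 1)) / (x ^+ 2 * (x + 1))); last first.
  by field; lra.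
rewrite divr_ge0// ?mulr_ge0 ?sqr_ge0//; last by lra.
have : 2 * s2 * a * (x + 1) <= x + 1 by rewrite ler_piMl//; lra.
lra.
Qed.

(** Each generation costs at most s2 times the square of the current survival probability, which is
    itself decreasing. *)
Lemma survival_prob_increment m j :
  survival_prob m - survival_prob (m + j) <= j%:R * (s2 * survival_prob m ^+ 2).
Proof.
have s20 : 0 <= s2.
  by rewrite fine_ge0// variance_mean1 expectation_ge0// => l; rewrite sqr_ge0.
elim: j => [|j IH]; first by rewrite addn0; lra.
rewrite addnS survival_probS -natr1 mulrDl mul1r.
have := pgf_upper (survival_prob_unit_itv (m + j)).
have : s2 * survival_prob (m + j) ^+ 2 <= s2 * survival_prob m ^+ 2.
  rewrite ler_wpM2l// lerXn2r// ?nnegrE ?survival_prob_le ?leq_addr//.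
  - by case/andP: (survival_prob_unit_itv (m + j)).
  - by case/andP: (survival_prob_unit_itv m).
lra.
Qed.

End CriticalPgf.

(** * Lower bound on the maximal occupation number *)

Section FrozenTreeProb.
Context {R : realType}.
Variables (Q : probability nat R) (d b : nat).

Definition frozen_step : R := fine (Q [set b]) * (2 * d + 1)%N%:R^-1 ^+ b.

Lemma frozen_step_unit_itv : 0 <= frozen_step <= 1.
Proof.
have q0 : 0 <= fine (Q [set b]) by rewrite fine_ge0.
have q1 : fine (Q [set b]) <= 1.
  by rewrite -lee_fin fineK ?fin_num_measure// probability_le1.
have c1 : (2 * d + 1)%N%:R^-1 <= 1 :> R.
  by rewrite invf_le1 ?ltr0n ?ler1n addn1.
by rewrite mulr_ge0 ?exprn_ge0//= mulr_ile1// ?exprn_ge0// exprn_ile1.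
Qed.

Lemma frozen_tree_prob_unit_itv k : 0 <= frozen_tree_prob Q d b k <= 1.
Proof.
have /andP[th0 th1] := frozen_step_unit_itv.
elim: k => [|k /andP[IH0 IH1]]; first by rewrite /= ler01 lexx.
rewrite [frozen_tree_prob _ _ _ _]/= [X in _ * X]exprMn mulrA -/frozen_step.
by rewrite mulr_ge0 ?exprn_ge0//= mulr_ile1// ?exprn_ge0// exprn_ile1.
Qed.

Lemma frozen_tree_prob_lower k : (2 <= b)%N ->
  frozen_step ^+ (b ^ k) <= frozen_tree_prob Q d b k.
Proof.
move=> b2; have /andP[th0 th1] := frozen_step_unit_itv.
(* The exponent b^k is not stable under the recursion r -> th r^b, whereas b^k - 1 is: 1 + b (b^k -
   1) <= b^(k+1) - 1 as soon as b >= 2. *)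
apply: (@le_trans _ _ (frozen_step ^+ (b ^ k).-1)).
  by rewrite ler_wiXn2l ?th0// leq_pred.
elim: k => [|k IH]; first by rewrite expn0 expr0.
rewrite [frozen_tree_prob _ _ _ _]/= [X in _ <= _ * X]exprMn mulrA -/frozen_step.
have bk : (0 < b ^ k)%N by rewrite expn_gt0 (leq_trans _ b2).
apply: (@le_trans _ _ (frozen_step * (frozen_step ^+ (b ^ k).-1) ^+ b)).
  rewrite -exprM -exprS ler_wiXn2l ?th0// expnS.
  by move: bk; case: (b ^ k)%N => // x _; nia.
rewrite ler_wpM2l// lerXn2r// ?nnegrE ?exprn_ge0//.
by rewrite (le_trans _ IH)// exprn_ge0.
Qed.

End FrozenTreeProb.

(** * Choice of the scales as functions of n *)

Section ChoiceOfParameters.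
Context {R : realType}.

(** The least power of [b] that reaches [x] overshoots by a factor of at most [b], except when it is
    b^0 = 1; the summand 1 covers that case. *)
Lemma exists_expn_itv (b : nat) (x : R) : (2 <= b)%N -> 0 <= x ->
  exists k, x <= (b ^ k)%:R <= b%:R * x + 1.
Proof.
move=> b2 x0.
have ex : exists k, x <= (b ^ k)%:R.
  exists (Num.trunc x).+1; apply: ltW; apply: lt_le_trans (truncnS_gt x) _.
  by rewrite ler_nat ltnW// ltn_expl.
exists (ex_minn ex); case: ex_minnP => k xk kmin; rewrite xk /=.
case: k xk kmin => [|k] xk kmin; first by rewrite expn0 lerDr mulr_ge0.
have : (b ^ k)%:R < x by rewrite ltNge; apply/negP => /kmin; rewrite ltnn.
move=> /ltW kx; rewrite expnS natrM (@le_trans _ _ (b%:R * x))//.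
  by rewrite ler_wpM2l.
by rewrite lerDl.
Qed.

(** Combines 1 - r <= exp(-r) with exp(x) >= x^5 / 5!. The power 5 is chosen because [r * K%:R] will
    be of order t and p_n of order t^(-4), which leaves a factor 1/t. *)
Lemma pow_onem_le (r : R) (K : nat) : 0 <= r <= 1 -> 0 < r * K%:R ->
  (1 - r) ^+ K <= 120 / (r * K%:R) ^+ 5.
Proof.
move=> /andP[r0 r1] rK.
apply: (@le_trans _ _ (expR (- r) ^+ K)).
  by rewrite lerXn2r// ?nnegrE ?expR_ge0//; [lra|exact: expR_ge1Dx].
rewrite -expRM_natl mulrN expRN mulrC.
rewrite -[leRHS]invrK lef_pV2 ?posrE ?expR_gt0 ?invr_gt0 ?divr_gt0 ?exprn_gt0//.
have /le_trans : (r * K%:R) ^+ 5 / 5`!%:R <= 1 + (r * K%:R) ^+ 5 / 5`!%:R by lra.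
by rewrite invf_div; apply; rewrite expR_ge1Dxn// ltW.
Qed.

Variable Q : probability nat R.
Hypothesis mean1 : ('E_Q[fun l : nat => l%:R : R] = 1)%E.
Hypothesis var_fin : ('V_Q[fun l : nat => l%:R : R] < +oo)%E.
Variables (d b : nat).
Hypothesis b2 : (2 <= b)%N.
Hypothesis Qb : 0 < fine (Q [set b]).

(** The value of delta: it makes b delta ln(t^4) (1 - ln th) equal to ln t. The summand 1 keeps the
    last factor at least 1. *)
Definition threshold : R := (4 * b%:R * (1 - ln (frozen_step Q d b)))^-1.

Lemma frozen_step_gt0 : 0 < frozen_step Q d b.
Proof. by rewrite mulr_gt0// exprn_gt0// invr_gt0 ltr0n addn1. Qed.

Lemma ln_frozen_step_le0 : ln (frozen_step Q d b) <= 0.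
Proof. by rewrite ln_le0//; case/andP: (frozen_step_unit_itv Q d b). Qed.

Lemma threshold_gt0 : 0 < threshold.
Proof.
have b0 : 0 < b%:R :> R by rewrite ltr0n (leq_trans _ b2).
have := ln_frozen_step_le0 => l0.
by rewrite invr_gt0 mulr_gt0//; [rewrite mulr_gt0|lra].
Qed.

Local Notation p := (survival_prob Q).
Local Notation r := (frozen_tree_prob Q d b).
Local Notation th := (frozen_step Q d b).

(* t stands for n^(1/4), the scale on which all the errors are measured. *)
Lemma frozen_tree_prob_threshold (t : R) (k : nat) : 1 <= t ->
  (b ^ k)%:R <= b%:R * (threshold * ln (t ^+ 4)) + 1 ->
  th / t <= r k /\ k%:R <= t.
Proof.
move=> t1 bk; have t0 : 0 < t by lra.
have b0 : 0 < b%:R :> R by rewrite ltr0n (leq_trans _ b2).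
have l0 := ln_frozen_step_le0; have th0 := frozen_step_gt0.
have lt0 : 0 <= ln t by rewrite ln_ge0.
(* That is, (b^k - 1)(1 - ln th) <= ln t. Both claims follow: th^(b^k) >= th / t, and k <= b^k <= ln
   t + 1 <= t. *)
have {}bk : (b ^ k)%:R * (1 - ln th) <= ln t + (1 - ln th).
  rewrite -ler_pdivlMr; last by lra.
  apply: (le_trans bk); rewrite /threshold lnXn//.
  rewrite le_eqVlt; apply/orP; left; apply/eqP.
  rewrite -(mulr_natr (ln t)); field.
  by rewrite (gt_eqF b0) /=; lra.
split.
  apply: le_trans (frozen_tree_prob_lower Q d k b2).
  rewrite -[X in X / t](@lnK _ th) ?posrE// -[X in _ / X](@lnK _ t) ?posrE//.
  rewrite -expRN -expRD -[X in X ^+ _](@lnK _ th) ?posrE// -expRM_natl ler_expR.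
  have : 1 <= (b ^ k)%:R :> R by rewrite ler1n expn_gt0 (leq_trans _ b2).
  by lra.
apply: (@le_trans _ _ (ln t + 1)); last first.
  have : ln (1 + (t - 1)) <= t - 1 by apply: le_ln1Dx; lra.
  by rewrite (_ : 1 + (t - 1) = t); [lra|ring].
have kb : k%:R <= (b ^ k)%:R :> R by rewrite ler_nat ltnW// ltn_expl.
apply: (le_trans kb).
have : 1 <= (b ^ k)%:R :> R by rewrite ler1n expn_gt0 (leq_trans _ b2).
move: bk l0; set x := (b ^ k)%:R; set l := ln th => bk l0 x1.
have : 0 <= (x - 1) * (- l) by rewrite mulr_ge0//; lra.
lra.
Qed.

Let s2 := fine 'V_Q[fun l : nat => l%:R : R].
Let c := fine (Q [set b]).

(** The first summand pays for a small generation [m], the second for the absence of frozen trees,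
    each in units of p_n / t. *)
Definition error_constant : R :=
  24 * s2 / c ^+ 2 + 240 * (2 / th) ^+ 5 * (1 + 2 * s2).

Lemma variance_fine_ge0 : 0 <= s2.
Proof. by rewrite fine_ge0// (variance_mean1 mean1) expectation_ge0// => l; rewrite sqr_ge0. Qed.

Lemma error_bound (n : nat) (t : R) : n%:R = t ^+ 4 -> 2 <= t -> 4 * s2 <= c * t ->
  exists m k K j, [/\ (m + k)%N = n, threshold * ln n%:R <= (b ^ k)%:R,
    K%:R * p j <= 1 / 2 &
    2 * (p m - p (m + j)) + (1 - r k) ^+ K <= error_constant / t * p n].
Proof.
move=> nt t2 st; have s20 := variance_fine_ge0.
have c0 : 0 < c by []. have t0 : 0 < t by lra.
have th0 := frozen_step_gt0.
have c1 : c <= 1 by rewrite -lee_fin fineK ?fin_num_measure// probability_le1.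
have t22 : 4 <= t ^+ 2 by rewrite (_ : 4 = 2 ^+ 2) ?lerXn2r ?nnegrE//; [lra|ring].
have n1 : 1 <= n%:R :> R by rewrite nt exprn_ege1//; lra.
have [|k /andP[k1 k2]] := @exists_expn_itv b (threshold * ln n%:R) b2.
  by rewrite mulr_ge0 ?ln_ge0// ltW// threshold_gt0.
have t1 : 1 <= t by lra.
have [rt kt] := frozen_tree_prob_threshold t1 (eq_ind _ (fun x => _ <= _ * (_ * ln x) + 1) k2 _ nt).
have r01 := frozen_tree_prob_unit_itv Q d b k.
(* K is of order sqrt n, and at least t^2 / 2 because t^2 >= 4. *)
pose K := Num.trunc (t ^+ 2).
have /andP[K1 K2] : K%:R <= t ^+ 2 < K%:R + 1.
  by rewrite natr1 truncn_itv// sqr_ge0.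
(* Rounding up gives 2K <= c j, and p_j (1 + c j) <= 1 then yields K p_j <= 1/2. *)
pose j := (Num.trunc (2 * K%:R / c)).+1.
have jK0 : 0 <= 2 * K%:R / c by rewrite divr_ge0 ?mulr_ge0// ltW.
have j1 : 2 * K%:R / c <= j%:R by rewrite ltW// truncnS_gt.
have j2 : j%:R <= 2 * K%:R / c + 1 by rewrite /j -natr1 lerD2r truncn_le.
have kn : 2 * k%:R <= n%:R :> R.
  rewrite nt; apply: (@le_trans _ _ (t ^+ 2 * 1)); first nra.
  by rewrite (_ : t ^+ 4 = t ^+ 2 * t ^+ 2); [rewrite ler_wpM2l; lra|ring].
have kn' : (k <= n)%N by rewrite -(ler_nat R); have := ler0n R k; lra.
pose m := (n - k)%N.
have mk : (m + k)%N = n by rewrite subnK.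
have mR : m%:R = n%:R - k%:R :> R by rewrite natrB.
(* Here m >= n/2, since 2k <= n. *)
have pm : p m * (c * t ^+ 4) <= 2.
  have := survival_prob_upper mean1 m b2; rewrite -/c mR.
  have /andP[p0 _] := survival_prob_unit_itv Q m.
  have : p m * c * n%:R <= p m * c * (2 * (n%:R - k%:R)).
    by rewrite ler_wpM2l ?mulr_ge0//; [exact: ltW|lra].
  rewrite nt; set x := t ^+ 4; nra.
have /andP[pm0 _] := survival_prob_unit_itv Q m.
(* The loss over the last k <= t generations is at most k s2 p_m^2, and 4 s2 <= c t makes this at
   most p_m / 2. *)
have pn2 : p m <= 2 * p n.
  have := survival_prob_increment mean1 var_fin m k; rewrite mk -/s2.
  suff : k%:R * (s2 * p m ^+ 2) <= p m / 2 by lra.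
  have : k%:R * (s2 * p m) <= 1 / 2; last first.
    by move=> /(ler_wpM2r pm0); lra.
  have : p m * t <= 2 / (c * t ^+ 3).
    rewrite ler_pdivlMr ?mulr_gt0 ?exprn_gt0//.
    by rewrite (_ : p m * t * (c * t ^+ 3) = p m * (c * t ^+ 4))//; ring.
  have : k%:R * (s2 * p m) <= s2 * (p m * t).
    rewrite mulrCA ler_wpM2l// mulrC; exact: ler_wpM2l.
  have : s2 * (2 / (c * t ^+ 3)) <= 1 / 2.
    rewrite mulrA ler_pdivrMr ?mulr_gt0 ?exprn_gt0//.
    have : c * t * 1 <= c * t * t ^+ 2 by rewrite ler_wpM2l ?mulr_ge0//; lra.
    by rewrite (_ : t ^+ 3 = t * t ^+ 2); [lra|ring].
  move=> H1 H2 /(ler_wpM2l s20); lra.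
exists m, k, K, j; split => //.
  have := survival_prob_upper mean1 j b2; rewrite -/c.
  have /andP[p0 _] := survival_prob_unit_itv Q j.
  have : 2 * K%:R <= c * j%:R by rewrite [leRHS]mulrC -ler_pdivrMr.
  move=> /(ler_wpM2l p0); lra.
(* With j <= 3t^2/c, one factor of p_m^2 is bounded by 2/(c t^4) and the other by 2 p_n. This has
   order p_n / t^2, better than required. *)
have first : 2 * (p m - p (m + j)) <= 24 * s2 / c ^+ 2 / t * p n.
  have := survival_prob_increment mean1 var_fin m j; rewrite -/s2 => incr.
  have j3 : j%:R <= 3 * t ^+ 2 / c.
    apply: (le_trans j2); rewrite ler_pdivlMr// mulrDl mul1r divfK ?gt_eqF//; lra.
  have pm' : p m <= 2 / (c * t ^+ 4) by rewrite ler_pdivlMr// mulr_gt0 ?exprn_gt0.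
  have : j%:R * (s2 * p m ^+ 2) <= 3 * t ^+ 2 / c * (s2 * (2 / (c * t ^+ 4) * (2 * p n))).
    apply: ler_pM => //; first by rewrite mulr_ge0 ?sqr_ge0.
    by rewrite ler_wpM2l// expr2 ler_pM.
  rewrite (_ : 3 * t ^+ 2 / c * _ = 12 * s2 / c ^+ 2 / t ^+ 2 * p n); last first.
    by field; rewrite !gt_eqF.
  move=> H; apply: (@le_trans _ _ (24 * s2 / c ^+ 2 / t ^+ 2 * p n)); first lra.
  rewrite ler_wpM2r//; first by case/andP: (survival_prob_unit_itv Q n).
  rewrite ler_wpM2l ?divr_ge0 ?mulr_ge0 ?sqr_ge0 ?(ltW c0)//.
  by rewrite lef_pV2 ?posrE ?exprn_gt0// expr2 ler_peMl//; lra.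
have t41 : 1 <= t ^+ 4 by rewrite -nt.
(* As r_k K >= th t / 2, the power is O(t^(-5)), while p_n is at least 1/(2 (1 + 2 s2) t^4). *)
have second : (1 - r k) ^+ K <= 240 * (2 / th) ^+ 5 * (1 + 2 * s2) / t * p n.
  have rK : th * t / 2 <= r k * K%:R.
    apply: (@le_trans _ _ (th / t * (t ^+ 2 / 2))).
      by rewrite le_eqVlt; apply/orP; left; apply/eqP; field; rewrite gt_eqF.
    by apply: ler_pM => //; [rewrite divr_ge0// ltW|rewrite divr_ge0// sqr_ge0|lra].
  have tht : 0 < th * t / 2 by rewrite divr_gt0 ?mulr_gt0.
  have : (1 - r k) ^+ K <= 120 / (r k * K%:R) ^+ 5.
    by apply: pow_onem_le => //; exact: lt_le_trans rK.
  move=> /le_trans; apply.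
  apply: (@le_trans _ _ (120 / (th * t / 2) ^+ 5)).
    rewrite ler_wpM2l// lef_pV2 ?posrE ?exprn_gt0//; last exact: lt_le_trans rK.
    by rewrite lerXn2r// ?nnegrE ltW//; exact: lt_le_trans rK.
  have a0 : 0 < 1 + 2 * s2 by lra.
  have := @survival_prob_lower _ _ mean1 var_fin (1 + 2 * s2)^-1 n.
  rewrite -/s2 -(natr1 n) nt => low.
  have {}low : 1 <= 2 * (1 + 2 * s2) * t ^+ 4 * p n.
    have : (1 + 2 * s2)^-1 / (t ^+ 4 + 1) <= p n.
      apply: low; first by rewrite invr_ge0 ltW//= invf_le1//; lra.
      by rewrite ler_pdivrMr//; lra.
    rewrite -invfM -[X in X <= _]mul1r ler_pdivrMr; last by rewrite mulr_gt0// addr_gt0// exprn_gt0.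
    have : p n * ((1 + 2 * s2) * (t ^+ 4 + 1)) <= p n * ((1 + 2 * s2) * (2 * t ^+ 4)).
      rewrite ler_wpM2l//; first by case/andP: (survival_prob_unit_itv Q n).
      by rewrite ler_wpM2l ?(ltW a0)//; lra.
    lra.
  rewrite -[leLHS]mulr1.
  apply: le_trans (ler_wpM2l _ low) _; first by rewrite divr_ge0// exprn_ge0// ltW.
  rewrite le_eqVlt; apply/orP; left; apply/eqP; field.
  by rewrite !gt_eqF.
have distr (x y u v : R) : (x + y) / u * v = x / u * v + y / u * v by rewrite !mulrDl.
by rewrite /error_constant distr; exact: lerD.
Qed.

End ChoiceOfParameters.

(** * From the error estimates to the conditional probability *)

Section MaximalOccupation.
Context {dOm : measure_display} {Omega : measurableType dOm} {R : realType}.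
Context {P : probability Omega R} {d : nat}.
Context {offspring : label -> {RV P >-> nat}}
        {step : label -> nat -> {RV P >-> site d}}.
Context {Q : probability nat R}.
Hypothesis brw : is_brw offspring step Q.

Local Notation gen := (generation offspring).
Local Notation p := (survival_prob Q).

Lemma survival_measurable n : measurable (survival offspring n).
Proof.
exact: (generation_measurable (step := step) n [set L | (0 < size L)%N]).
Qed.

Lemma survival_probE n : P (survival offspring n) = (p n)%:E.
Proof.
have -> : survival offspring n = ~` [set w | descendants offspring n [::] w = [::]].
  apply/seteqP; split => w; rewrite /survival /= /descendants -generation_iter.
    by case: (gen n w).
  by case: (gen n w).
rewrite probability_setC ?(extinct_prob brw) ?EFinB//.
have := generation_measurable (offspring := offspring) (step := step) n [set [::]].
by congr measurable; apply/seteqP; split => w; rewrite /= /descendants -generation_iter.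
Qed.

(** [V] depends only on the list of positions of generation [n], a variable with countably many
    values, so any function of it is measurable. *)
Lemma V_ge_measurable n (x : \bar R) :
  measurable [set w | (x <= V offspring step n w)%E].
Proof.
have sm := sigma_algebra_measurable Omega.
pose f (s : seq (site d)) : \bar R :=
  ereal_sup [set ((count_mem x s)%:R)%:E | x in [set: site d]].
have VE w : V offspring step n w = f [seq position step u w | u <- gen n w].
  by rewrite /V /f; congr ereal_sup; apply: eq_imagel => y _; rewrite /U count_map.
have mpos : discrete_wrt measurable (fun w => [seq position step u w | u <- gen n w]).
  apply: (discrete_wrt_bind (Y := fun L w => [seq position step u w | u <- L]) sm).
    exact: (generation_measurable (step := step) n).
  by move=> L; apply: discrete_wrt_map => // u _; exact: position_discrete.
have := mpos [set s | (x <= f s)%E].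
by congr measurable; apply/seteqP; split => w /=; rewrite VE.
Qed.

(* A small m-th generation is extinct j generations later with probability at
   least 1/2, so its probability is controlled by that of extinction between
   times m and m + j. *)
Lemma small_generation_le m j K : K%:R * p j <= 1 / 2 ->
  fine (P [set w | (0 < size (gen m w) <= K)%N]) <= 2 * (p m - p (m + j)).
Proof.
move=> Kp.
pose F u w := descendants offspring j u w == [::].
have FD u : discrete_wrt (sigma_of (driving_sigma offspring step) (subtree u)) (F u).
  apply: (discrete_wrt_comp (fun s => s == [::])); first exact: sigma_of_sigma_algebra.
  exact: descendants_discrete.
have FP u : P [set w | F u w] = (extinction Q j)%:E.
  rewrite -(extinct_prob brw j u); congr (P _).
  by apply/seteqP; split => w /eqP.
have := branching_ge brw FD FP (extinction_unit_itv Q j) m K.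
set B := [set w | (0 < _ <= _)%N]; set A := [set w | all _ _] => ge.
have mB : measurable B.
  exact: (generation_measurable (step := step) m [set L | (0 < size L <= K)%N]).
have mA : measurable A by exact: (all_generation_measurable FD).
(* Extinction by time m + j from a nonempty generation m is disjoint from survival to m + j, and
   both imply survival to m. *)
have BA : fine (P (B `&` A)) + p (m + j) <= p m.
  rewrite -lee_fin EFinD fineK ?fin_num_measure//; last exact: measurableI.
  rewrite -!survival_probE -measureU//; first last.
  - apply/seteqP; split => // w [[_ /allP Aw]]; rewrite /survival /= generationD.
    rewrite (_ : flatten _ = [::])//.
    elim: (gen m w) Aw => //= u s IH Aw.
    rewrite (eqP (Aw u (mem_head _ _))) IH// => v vs.
    by apply: Aw; rewrite inE vs orbT.
  - exact: survival_measurable.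
  - exact: measurableI.
  apply: le_measure; rewrite ?inE.
  - by apply: measurableU; [exact: measurableI|exact: survival_measurable].
  - exact: survival_measurable.
  move=> w [[/= /andP[]]//|]; rewrite /survival /= generationD.
  by case: (gen m w).
(* Bernoulli's inequality: (1 - p_j)^K >= 1 - K p_j. *)
have half : 1 / 2 <= extinction Q j ^+ K.
  have -> : extinction Q j = 1 - p j by rewrite /survival_prob subKr.
  have /andP[p0 p1] := survival_prob_unit_itv Q j.
  suff : 1 - K%:R * p j <= (1 - p j) ^+ K by lra.
  elim: (K) => [|n IH]; first by rewrite expr0; lra.
  rewrite exprS -natr1.
  have : (1 - p j) * (1 - n%:R * p j) <= (1 - p j) * (1 - p j) ^+ n.
    by rewrite ler_wpM2l//; lra.
  have : 0 <= n%:R * p j ^+ 2 by rewrite mulr_ge0 ?sqr_ge0.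
  lra.
move: ge; rewrite -(@fineK _ (P B)) ?fin_num_measure// -(@fineK _ (P (B `&` A))).
  rewrite -EFinM lee_fin => ge.
  have : 1 / 2 * fine (P B) <= extinction Q j ^+ K * fine (P B).
    by rewrite ler_wpM2r// fine_ge0.
  lra.
by rewrite fin_num_measure//; exact: measurableI.
Qed.

Let no_frozen_tree b k u w := ~~ frozen_tree offspring step b k u w.

Lemma no_frozen_tree_discrete b k u :
  discrete_wrt (sigma_of (driving_sigma offspring step) (subtree u)) (no_frozen_tree b k u).
Proof.
apply: (discrete_wrt_comp negb); first exact: sigma_of_sigma_algebra.
exact: frozen_tree_discrete.
Qed.

Lemma many_no_frozen_tree_measurable b m k K :
  measurable ([set w | (K <= size (gen m w))%N] `&`
              [set w | all ((no_frozen_tree b k)^~ w) (gen m w)]).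
Proof.
apply: measurableI.
  exact: (generation_measurable (step := step) m [set L | (K <= size L)%N]).
exact: (all_generation_measurable (no_frozen_tree_discrete b k)).
Qed.

Lemma no_frozen_tree_le b m k K :
  fine (P ([set w | (K <= size (gen m w))%N] `&`
           [set w | all ((no_frozen_tree b k)^~ w) (gen m w)]))
    <= (1 - frozen_tree_prob Q d b k) ^+ K.
Proof.
have FP u : P [set w | no_frozen_tree b k u w] = (1 - frozen_tree_prob Q d b k)%:E.
  rewrite EFinB -(frozen_tree_probE brw b k u) -probability_setC.
    by congr (P _); apply/seteqP; split => w /negP.
  apply: (sigma_of_sub_measurable (@driving_sigma_measurable _ _ _ _ _ offspring step)).
  exact: (frozen_tree_discrete b k [set true]).
have F01 : 0 <= 1 - frozen_tree_prob Q d b k <= 1.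
  by have := frozen_tree_prob_unit_itv Q d b k; lra.
rewrite -lee_fin fineK ?fin_num_measure//; last exact: many_no_frozen_tree_measurable.
exact: (branching_le brw (no_frozen_tree_discrete b k) FP F01 m K).
Qed.

Lemma cond_prob_lower (x : R) b m k K j : x <= (b ^ k)%:R ->
  K%:R * p j <= 1 / 2 -> 0 < p (m + k) ->
  1 - (2 * (p m - p (m + j)) + (1 - frozen_tree_prob Q d b k) ^+ K) / p (m + k) <=
  cond_prob P [set w | (x%:E <= V offspring step (m + k) w)%E]
    (survival offspring (m + k)) <= 1.
Proof.
move=> xb Kp pn; rewrite /cond_prob survival_probE /=.
set A := [set w | (_ <= _)%E]; set G := survival _ _.
have mA : measurable A by exact: V_ge_measurable.
have mG : measurable G by exact: survival_measurable.
have mAG : measurable (A `&` G) by exact: measurableI.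
set B1 := [set w | (0 < size (gen m w) <= K)%N].
set B2 := [set w | (K <= size (gen m w))%N] `&`
  [set w | all ((no_frozen_tree b k)^~ w) (gen m w)].
apply/andP; split; last first.
  rewrite ler_pdivrMr// mul1r -lee_fin fineK ?fin_num_measure// -survival_probE.
  by apply: le_measure; rewrite ?inE//; exact: subIsetr.
rewrite ler_pdivlMr// mulrBl mul1r divfK ?gt_eqF// lerBlDr.
have mB1 : measurable B1.
  exact: (generation_measurable (step := step) m [set L | (0 < size L <= K)%N]).
have mB2 : measurable B2 by exact: many_no_frozen_tree_measurable.
(* On survival, either generation m has at most K particles, or it has at least K of which none
   starts a frozen tree, or some frozen tree puts b^k >= x particles at one site. *)
have cover : G `<=` (A `&` G) `|` (B1 `|` B2).
  move=> w Gw.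
  have m0 : (0 < size (gen m w))%N.
    by move: Gw; rewrite /G /survival /= generationD; case: (gen m w).
  have [Km|mK] := leqP K (size (gen m w)); last by right; left; rewrite /B1 /= m0 ltnW.
  have [noft|] := boolP (all ((no_frozen_tree b k)^~ w) (gen m w)).
    by right; right; split.
  rewrite -has_predC => /hasP[u um /= /negPn ft]; left; split => //.
  rewrite /A /=; apply: (@le_trans _ _ ((U offspring step (m + k) (position step u w) w)%:R)%:E).
    rewrite lee_fin (le_trans xb)// ler_nat; exact: frozen_tree_U.
  by apply: ereal_sup_ubound; exists (position step u w).
have H : (P G <= P (A `&` G) + (P B1 + P B2))%E.
  have mU : measurable (B1 `|` B2) by exact: measurableU.
  apply: (@le_trans _ _ (P ((A `&` G) `|` (B1 `|` B2)))).
    by apply: le_measure; rewrite ?inE//; exact: measurableU.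
  apply: (le_trans (measureU2 _ _ _)) => //.
  by rewrite leeD2l//; exact: measureU2.
move: H; rewrite survival_probE -(@fineK _ (P (A `&` G))) ?fin_num_measure//.
rewrite -(@fineK _ (P B1)) ?fin_num_measure// -(@fineK _ (P B2)) ?fin_num_measure//.
rewrite -!EFinD lee_fin => H.
have := small_generation_le m Kp; have := no_frozen_tree_le b m k K.
rewrite -/B1 -/B2; lra.
Qed.

End MaximalOccupation.

Lemma survival_prob_gt0 (R : realType) (Q : probability nat R) n :
  ('E_Q[fun l : nat => l%:R : R] = 1)%E ->
  ('V_Q[fun l : nat => l%:R : R] < +oo)%E -> 0 < survival_prob Q n.
Proof.
move=> mean1 var_fin.
have s20 := variance_fine_ge0 mean1.
pose a : R := (1 + 2 * fine 'V_Q[fun l : nat => l%:R : R])^-1.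
have a0 : 0 < a by rewrite invr_gt0; lra.
apply: (@lt_le_trans _ _ (a / n.+1%:R)); first by rewrite divr_gt0.
apply: survival_prob_lower => //.
  by rewrite ltW//= invf_le1; lra.
by rewrite ler_pdivrMr; lra.
Qed.

Theorem theorem4 (R : realType) (d : nat) (hd : (2 <= d)%N)
    (Q : probability nat R)
    (mean1 : ('E_Q[fun l : nat => l%:R : R] = 1)%E)
    (var_gt0 : (0 < 'V_Q[fun l : nat => l%:R : R])%E)
    (var_fin : ('V_Q[fun l : nat => l%:R : R] < +oo)%E) :
  exists2 delta : R, 0 < delta &
    forall (dOm : measure_display) (Omega : measurableType dOm)
      (P : probability Omega R)
      (offspring : label -> {RV P >-> nat})
      (step : label -> nat -> {RV P >-> site d}),
      is_brw offspring step Q ->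
      cond_prob P [set w | ((delta * ln n%:R)%:E <= V offspring step n w)%E]
                  (survival offspring n) @[n --> \oo] --> (1 : R).
Proof.
have [b b2 Qb] := exists_branching mean1 var_gt0.
exists (threshold Q d b); first exact: threshold_gt0.
move=> dOm Omega P offspring step brw.
apply/cvgrPdist_le => eps eps0.
pose C := error_constant Q d b; pose s2 := fine 'V_Q[fun l : nat => l%:R : R].
(* For t >= T the three summands give in turn t >= 2, 4 s2 <= c t (both required by [error_bound])
   and C / t <= eps. *)
pose T : R := 2 + 4 * s2 / fine (Q [set b]) + C / eps.
have s20 : 0 <= s2 by exact: variance_fine_ge0.
have th0 := frozen_step_gt0 d Qb.
have C0 : 0 <= C.
  rewrite /C /error_constant -/s2 addr_ge0//.
    by rewrite divr_ge0 ?mulr_ge0 ?exprn_ge0 ?(ltW Qb).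
  have th5 : 0 <= (2 / frozen_step Q d b) ^+ 5 by rewrite exprn_ge0// divr_ge0// ltW.
  by rewrite mulr_ge0//; [rewrite mulr_ge0|lra].
have T1 : 0 <= 4 * s2 / fine (Q [set b]) by rewrite divr_ge0 ?mulr_ge0 ?(ltW Qb).
have T2 : 0 <= C / eps by rewrite divr_ge0 ?(ltW eps0).
exists (Num.trunc (T ^+ 4)).+1 => // n /= Nn.
(* The fourth root of n; n > T^4 ensures t >= T. *)
pose t : R := Num.sqrt (Num.sqrt n%:R).
have nt : n%:R = t ^+ 4 by rewrite (exprM _ 2 2) !sqr_sqrtr ?sqrtr_ge0.
have Tt : T <= t.
  rewrite leNgt; apply/negP => tT.
  have : t ^+ 4 < T ^+ 4 by rewrite ltrXn2r// ?nnegrE ?sqrtr_ge0//; rewrite /T; lra.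
  rewrite -nt ltNge => /negP; apply; apply: ltW.
  by apply: lt_le_trans (truncnS_gt _) _; rewrite ler_nat.
have t2 : 2 <= t by move: Tt; rewrite /T; lra.
have t0 : 0 < t by lra.
have st : 4 * s2 <= fine (Q [set b]) * t.
  by rewrite [leRHS]mulrC -ler_pdivrMr//; move: Tt; rewrite /T; lra.
have [m [k [K [j [mk bk Kp err]]]]] := error_bound mean1 var_fin d b2 Qb nt t2 st.
have pn := survival_prob_gt0 n mean1 var_fin.
rewrite -mk in pn err bk *.
have /andP[lo hi] := cond_prob_lower brw bk Kp pn.
rewrite ger0_norm ?subr_ge0// lerBlDr -lerBlDl.
apply: le_trans lo; rewrite lerD2l lerN2 ler_pdivrMr//.
apply: (le_trans err); rewrite ler_wpM2r ?(ltW pn)//.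
rewrite ler_pdivrMr// [leRHS]mulrC -ler_pdivrMr//.
by rewrite -/C; move: Tt; rewrite /T; lra.
Qed.
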